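(* Let $\mathcal{Q}$ and $\mathcal{Q}'$ be seminormal quasi-crystals of the same type with underlying sets $Q,Q'$, and let $\psi:Q\to Q'$ be a map. Then $\psi$ (extended by $\psi(\bot)=\bot$) is a quasi-crystal isomorphism between $\mathcal{Q}$ and $\mathcal{Q}'$ if and only if $\psi$ is an isomorphism between the weighted labelled directed graphs $\Gamma_{\mathcal{Q}}$ and $\Gamma_{\mathcal{Q}'}$.
   Context: Root system data: $V$ a finite-dimensional real inner product space, $\alpha^\vee=\frac{2}{\langle\alpha,\alpha\rangle}\alpha$; a root system $\Phi$ with fixed simple roots $(\alpha_i)_{i\in I}$ and weight lattice $\Lambda$ (a $\mathbb{Z}$-submodule of $V$ spanning $V$, containing $\Phi$, with $\langle\lambda,\alpha^\vee\rangle\in\mathbb{Z}$ for $\alpha\in\Phi$). A quasi-crystal of type $\Phi$ is a set $Q$ with maps $\mathrm{wt}:Q\to\Lambda$, $\ddot{e}_i,\ddot{f}_i:Q\to Q\sqcup\{\bot\}$ ($\bot$ = undefined), $\ddot{\varepsilon}_i,\ddot{\varphi}_i:Q\to\mathbb{Z}\cup\{\pm\infty\}$ ($i\in I$) such that for all $x,y$: $\ddot{\varphi}_i(x)=\ddot{\varepsilon}_i(x)+\langle\mathrm{wt}(x),\alpha_i^\vee\rangle$ (with $m+(\pm\infty)=\pm\infty$); if $\ddot{e}_i(x)\in Q$ then $\mathrm{wt}(\ddot{e}_i(x))=\mathrm{wt}(x)+\alpha_i$, $\ddot{\varepsilon}_i(\ddot{e}_i(x))=\ddot{\varepsilon}_i(x)-1$,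 $\ddot{\varphi}_i(\ddot{e}_i(x))=\ddot{\varphi}_i(x)+1$; if $\ddot{f}_i(x)\in Q$ then $\mathrm{wt}(\ddot{f}_i(x))=\mathrm{wt}(x)-\alpha_i$, $\ddot{\varepsilon}_i(\ddot{f}_i(x))=\ddot{\varepsilon}_i(x)+1$, $\ddot{\varphi}_i(\ddot{f}_i(x))=\ddot{\varphi}_i(x)-1$; $\ddot{e}_i(x)=y\iff x=\ddot{f}_i(y)$; $\ddot{\varepsilon}_i(x)=\pm\infty$ implies $\ddot{e}_i(x)=\ddot{f}_i(x)=\bot$. It is seminormal if whenever $\ddot{\varepsilon}_i(x)\ne+\infty$, $\ddot{\varepsilon}_i(x)=\max\{k\ge0:\ddot{e}_i^k(x)\in Q\}$ and $\ddot{\varphi}_i(x)=\max\{k\ge0:\ddot{f}_i^k(x)\in Q\}$. A quasi-crystal homomorphism $\psi:\mathcal{Q}\to\mathcal{Q}'$ is a map $Q\sqcup\{\bot\}\to Q'\sqcup\{\bot\}$ with $\psi(\bot)=\bot$ such that whenever $\psi(x)\in Q'$ it has the same $\mathrm{wt},\ddot{\varepsilon}_i,\ddot{\varphi}_i$ as $x$, and $\psi(\ddot{e}_i(x))=\ddot{e}_i(\psi(x))$ (resp. $\psi(\ddot{f}_i(x))=\ddot{f}_i(\psi(x))$) whenever $\ddot{e}_i(x)\in Q$ (resp. $\ddot{f}_i(x)\in Q$) and $\psi(x)$ and $\psi(\ddot{e}_i(x))$ (resp. $\psi(\ddot{f}_i(x))$) lie in $Q'$. A quasi-crystal isomorphism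 is a bijection $\psi$ with $\psi,\psi^{-1}$ homomorphisms. The quasi-crystal graph $\Gamma_{\mathcal{Q}}$ is the $\Lambda$-weighted (vertex $x$ has weight $\mathrm{wt}(x)$) $I$-labelled directed graph with vertex set $Q$, an edge $x\xrightarrow{i}y$ whenever $\ddot{f}_i(x)=y$, and a loop at $x$ labelled $i$ whenever $\ddot{\varepsilon}_i(x)=+\infty$. A homomorphism of such graphs is a weight-preserving map of vertices sending each edge $x\xrightarrow{i}y$ to an edge $\psi(x)\xrightarrow{i}\psi(y)$; an isomorphism is a bijective homomorphism whose inverse is a homomorphism. *)

(* Defs.v *)
From HB Require Import structures.
From mathcomp Require Import all_boot all_order all_algebra.
From mathcomp Require Import finmap.
From mathcomp Require Import reals constructive_ereal.

Set Implicit Arguments.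
Unset Strict Implicit.
Unset Printing Implicit Defensive.

Import Order.TTheory GRing.Theory Num.Theory.

Local Open Scope fset_scope.
Local Open Scope ring_scope.

(* [{dot V for idfun}] is the library's type of symmetric positive definite
   bilinear forms, so [dot] makes [V] a real inner product space. *)

Section RootSystem.
Context (R : realType) (V : vectType R) (dot : {dot V for idfun}).

Definition coroot (a : V) : V := (2 / dot a a) *: a.

Definition reflection (a v : V) : V := v - dot v (coroot a) *: a.

(* Crystallographic and reduced, not necessarily spanning [V]: in type A the
   usual choice is [Phi = {e_i - e_j}] in [V = R^n], with lattice [Z^n]. *)
Definition root_system (Phi : {fset V}) : Prop :=
  [/\ 0 \notin Phi,
      {in Phi &, forall a b, reflection a b \in Phi},
      {in Phi &, forall a b, dot b (coroot a) \is a Num.int}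
    & {in Phi, forall a (k : R), k *: a \in Phi -> k = 1 \/ k = -1}].

Definition simple_roots (I : finType) (Phi : {fset V}) (alpha : I -> V) :
  Prop :=
  [/\ forall i, alpha i \in Phi,
      free (codom alpha)
    & {in Phi, forall b, exists c : I -> nat,
        b = \sum_i alpha i *+ c i \/ b = - \sum_i alpha i *+ c i}].

Definition weight_lattice (Phi : {fset V}) (L : zmodClosed V) : Prop :=
  [/\ forall v : V, exists2 s : seq V, {subset s <= L} & v \in <<s>>%VS,
      {subset Phi <= L}
    & forall l a, l \in L -> a \in Phi -> dot l (coroot a) \is a Num.int].

End RootSystem.

Record cartan_type (R : realType) (V : vectType R) (dot : {dot V for idfun})
    (I : finType) := CartanType {
  roots : {fset V};
  sroot : I -> V;
  lattice : zmodClosed V;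
  rootsP : root_system dot roots;
  srootP : simple_roots roots sroot;
  latticeP : weight_lattice dot roots lattice }.

Section QuasiCrystal.
Context (R : realType) (V : vectType R) (dot : {dot V for idfun}).
Context (I : finType) (D : cartan_type dot I).

Definition weight : Type := {v : V | v \in lattice D}.

(* The pairing of a weight with a simple coroot; it is an integer, and [floor]
   only serves to give it the type [int], see [pairingE]. *)
Definition pairing (l : weight) (i : I) : int :=
  Num.floor (dot (val l) (coroot dot (sroot D i))).

Lemma pairingE (l : weight) (i : I) :
  (pairing l i)%:~R = dot (val l) (coroot dot (sroot D i)).
Proof.
rewrite /pairing; case: (latticeP D) => _ _ LZ; case: (srootP D) => aR _ _.
by apply/floorK/LZ; [exact: valP | exact: aR].
Qed.

(* [None] plays the role of the undefined symbol.  The sum of [\bar int]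
   satisfies [+oo + m%:E = +oo] and [-oo + m%:E = -oo]. *)
Record quasi_crystal := QuasiCrystal {
  qc_set :> Type;
  wt : qc_set -> weight;
  qe : I -> qc_set -> option qc_set;
  qf : I -> qc_set -> option qc_set;
  qeps : I -> qc_set -> \bar int;
  qphi : I -> qc_set -> \bar int;
  qphiE : forall i x, qphi i x = (qeps i x + (pairing (wt x) i)%:E)%E;
  qeP : forall i x y, qe i x = Some y ->
    [/\ val (wt y) = val (wt x) + sroot D i,
        qeps i y = (qeps i x - 1%:E)%E
      & qphi i y = (qphi i x + 1%:E)%E];
  qfP : forall i x y, qf i x = Some y ->
    [/\ val (wt y) = val (wt x) - sroot D i,
        qeps i y = (qeps i x + 1%:E)%E
      & qphi i y = (qphi i x - 1%:E)%E];
  qeqf : forall i x y, qe i x = Some y <-> Some x = qf i y;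
  qeps_infty : forall i x, qeps i x = +oo%E \/ qeps i x = -oo%E ->
    qe i x = None /\ qf i x = None }.

Definition is_max_iter (T : Type) (g : T -> option T) (x : T) (m : \bar int) :
  Prop :=
  exists n : nat,
    [/\ m = (Posz n)%:E,
        iter n (obind g) (Some x)
      & forall k : nat, iter k (obind g) (Some x) -> (k <= n)%N].

Definition seminormal (Q : quasi_crystal) : Prop :=
  forall i (x : Q), qeps i x <> +oo%E ->
    is_max_iter (qe i) x (qeps i x) /\ is_max_iter (qf i) x (qphi i x).

Definition qc_hom (Q Q' : quasi_crystal) (psi : option Q -> option Q') : Prop :=
  [/\ psi None = None,
      forall (x : Q) (x' : Q'), psi (Some x) = Some x' ->
        wt x' = wt x /\
        forall i, qeps i x' = qeps i x /\ qphi i x' = qphi i x,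
      forall i (x : Q), qe i x -> psi (Some x) -> psi (qe i x) ->
        psi (qe i x) = obind (qe i) (psi (Some x))
    & forall i (x : Q), qf i x -> psi (Some x) -> psi (qf i x) ->
        psi (qf i x) = obind (qf i) (psi (Some x))].

Definition qc_iso (Q Q' : quasi_crystal) (psi : option Q -> option Q') : Prop :=
  exists psi' : option Q' -> option Q,
    [/\ cancel psi psi', cancel psi' psi, qc_hom psi & qc_hom psi'].

End QuasiCrystal.

Record wl_digraph (W L : Type) := WLDigraph {
  vertex :> Type;
  vweight : vertex -> W;
  edge : L -> vertex -> vertex -> Prop }.

Definition graph_hom (W L : Type) (G G' : wl_digraph W L) (psi : G -> G') :
  Prop :=
  (forall x, vweight (psi x) = vweight x) /\
  (forall l x y, edge l x y -> edge l (psi x) (psi y)).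

Definition graph_iso (W L : Type) (G G' : wl_digraph W L) (psi : G -> G') :
  Prop :=
  exists psi' : G' -> G,
    [/\ cancel psi psi', cancel psi' psi, graph_hom psi & graph_hom psi'].

Definition qc_graph (R : realType) (V : vectType R) (dot : {dot V for idfun})
    (I : finType) (D : cartan_type dot I) (Q : quasi_crystal D) :
    wl_digraph (weight D) I :=
  WLDigraph (@wt _ _ _ _ _ Q)
    (fun i x y => qf i x = Some y \/ (x = y /\ qeps i x = +oo%E)).

(* Main.v *)
(* A homomorphism of quasi-crystals preserves weights, the operators where they
   are defined, and the places where epsilon is +oo, hence edges and loops.
   Conversely, since [f_i] changes the weight by the nonzero vector [alpha_i],
   an edge given by [f_i] is never a loop, so the graph determines [e_i], [f_i]
   and where [epsilon_i] is +oo.  Elsewhere seminormality expresses [epsilon_i]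
   as the length of an [e_i]-string, which a graph isomorphism preserves, and
   [phi_i] is determined by [epsilon_i] and the weight. *)

Require Import Defs.
From mathcomp Require Import all_boot all_order all_algebra.
From mathcomp Require Import reals constructive_ereal.

Set Implicit Arguments.
Unset Strict Implicit.
Unset Printing Implicit Defensive.

Import Order.TTheory GRing.Theory Num.Theory.

Local Open Scope ring_scope.

(** Applying [h] termwise turns a [g]-string of length [n] from [x] into a [g']-string of the same
    length from [h x], and [n'] bounds all of those. *)
Lemma is_max_iter_homo (T T' : Type) (g : T -> option T) (g' : T' -> option T')
    (h : T -> T') (x : T) (n n' : nat) :
  (forall a b, g a = Some b -> g' (h a) = Some (h b)) ->
  is_max_iter g x n%:Z%:E -> is_max_iter g' (h x) n'%:Z%:E -> (n <= n')%N.
Proof.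
move=> gg' [_ [[<-] gx _]] [_ [[<-] _]]; apply.
have iterh k y : iter k (obind g) (Some x) = Some y ->
    iter k (obind g') (Some (h x)) = Some (h y).
  elim: k y => [|k IHk] y /=; first by case=> <-.
  by case Ek: (iter k _ _) => [z|//] /= /gg'; rewrite (IHk z Ek).
by case En: (iter n _ _) gx => [y|//] _; rewrite (iterh n y En).
Qed.

Section QuasiCrystalGraph.
Context (R : realType) (V : vectType R) (dot : {dot V for idfun}).
Context (I : finType) (D : cartan_type dot I).

Lemma sroot_neq0 (i : I) : sroot D i != 0.
Proof.
case: (rootsP D) => N0 _ _ _; case: (srootP D) => aR _ _.
by apply: contraNneq N0 => <-.
Qed.

Lemma qf_wt_neq (Q : quasi_crystal D) i (x y : Q) :
  qf i x = Some y -> wt y <> wt x.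
Proof.
case/qfP=> wy _ _ E; move: (sroot_neq0 i).
by move/eqP: wy; rewrite E -subr_eq0 opprB addrCA subrr addr0 => ->.
Qed.

(** As [psi] is defined on all of [Q], the definedness guards in [qc_hom] hold along every edge
    given by [qf]; loops survive because [qeps] is preserved. *)
Lemma qc_hom_graph_hom (Q Q' : quasi_crystal D) (psi : option Q -> option Q')
    (g : Q -> Q') :
  (forall x, psi (Some x) = Some (g x)) -> qc_hom psi ->
  @graph_hom _ _ (qc_graph Q) (qc_graph Q') g.
Proof.
move=> psig [_ H1 _ H3]; split=> [x|i x y /= [fx|[<- ex]]].
- by have [] := H1 x _ (psig x).
- left; have := H3 i x; rewrite fx (psig x) (psig y) /=.
  by move=> /(_ isT isT isT).
- right; split=> //; have [_ /(_ i)[-> _]] := H1 x _ (psig x); exact: ex.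
Qed.

Section GraphHom.
Context (Q Q' : quasi_crystal D) (psi : Q -> Q').
Hypothesis psi_hom : @graph_hom _ _ (qc_graph Q) (qc_graph Q') psi.

(** The image edge could only fail to come from [qf] by being a loop, but its ends have the distinct
    weights of [x] and [y]. *)
Lemma graph_hom_qf i x y : qf i x = Some y -> qf i (psi x) = Some (psi y).
Proof.
case: psi_hom => wpsi epsi fx.
case: (epsi i x y (or_introl fx)) => [//|[E _]].
by case: (qf_wt_neq fx); rewrite -[LHS]wpsi -[RHS]wpsi E.
Qed.

Lemma graph_hom_qe i x y : qe i x = Some y -> qe i (psi x) = Some (psi y).
Proof. by move/qeqf/esym/graph_hom_qf => fy; apply/qeqf. Qed.

Lemma graph_hom_qeps_pinfty i x : qeps i x = +oo%E -> qeps i (psi x) = +oo%E.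
Proof.
case: psi_hom => _ epsi ex.
by case: (epsi i x x (or_intror (conj erefl ex))) => [/qf_wt_neq|[]].
Qed.

End GraphHom.

Lemma graph_iso_qeps (Q Q' : quasi_crystal D) (psi : Q -> Q') (psi' : Q' -> Q)
    i (x : Q) :
  seminormal Q -> seminormal Q' -> cancel psi psi' ->
  @graph_hom _ _ (qc_graph Q) (qc_graph Q') psi ->
  @graph_hom _ _ (qc_graph Q') (qc_graph Q) psi' ->
  qeps i (psi x) = qeps i x.
Proof.
move=> sQ sQ' psiK hpsi hpsi'.
have [ex|/eqP ex] := eqVneq (qeps i x) +oo%E.
  by rewrite ex (graph_hom_qeps_pinfty hpsi ex).
have ex' : qeps i (psi x) <> +oo%E.
  by move/(graph_hom_qeps_pinfty hpsi'); rewrite psiK.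
have [mx _] := sQ i x ex; have [mx' _] := sQ' i (psi x) ex'.
have [n [En _ _]] := mx; have [n' [En' _ _]] := mx'.
rewrite En in mx *; rewrite En' in mx' *; congr (_%:Z%:E).
(* Strings are compared in both directions: [psi'] gives one inequality and [psi] the other. *)
apply/eqP; rewrite eqn_leq; apply/andP; split.
  apply: (is_max_iter_homo (@graph_hom_qe _ _ _ hpsi' i) mx').
  by rewrite psiK.
exact: (is_max_iter_homo (@graph_hom_qe _ _ _ hpsi i) mx mx').
Qed.

Lemma graph_iso_qc_hom (Q Q' : quasi_crystal D) (psi : Q -> Q')
    (psi' : Q' -> Q) :
  seminormal Q -> seminormal Q' -> cancel psi psi' ->
  @graph_hom _ _ (qc_graph Q) (qc_graph Q') psi ->
  @graph_hom _ _ (qc_graph Q') (qc_graph Q) psi' ->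
  qc_hom (omap psi).
Proof.
move=> sQ sQ' psiK hpsi hpsi'; split=> //.
- move=> x _ [<-]; have wpsi : wt (psi x) = wt x by case: hpsi => /(_ x).
  split=> // i; have epsi := graph_iso_qeps i x sQ sQ' psiK hpsi hpsi'.
  by rewrite !qphiE epsi wpsi.
- by move=> i x; case E: (qe i x) => [y|//] _ _ _; rewrite /= (graph_hom_qe hpsi E).
- by move=> i x; case E: (qf i x) => [y|//] _ _ _; rewrite /= (graph_hom_qf hpsi E).
Qed.

End QuasiCrystalGraph.

Theorem theorem4p13 (R : realType) (V : vectType R) (dot : {dot V for idfun}%R)
    (I : finType) (D : cartan_type dot I) (Q Q' : quasi_crystal D)
    (hQ : seminormal Q) (hQ' : seminormal Q') (psi : Q -> Q') :
  qc_iso (omap psi) <-> @graph_iso _ _ (qc_graph Q) (qc_graph Q') psi.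
Proof.
split=> [[phi [psiK phiK hpsi hphi]]|[psi' [psiK psi'K hpsi hpsi']]].
(* [phi] cannot send [Some y] to [None], since [omap psi] would then return [None] instead of
   [Some y]; so [phi] restricts to a map of vertices. *)
- have phiS y : {x | phi (Some y) = Some x}.
    by case E: (phi (Some y)) (phiK (Some y)) => [x|//] _; exists x.
  exists (fun y => sval (phiS y)); split.
  + move=> x; case: (phiS _) => z /= Ez.
    by have := psiK (Some x); rewrite /= Ez => -[].
  + move=> y; case: (phiS _) => z /= Ez.
    by have := phiK (Some y); rewrite /= Ez => -[].
  + exact: qc_hom_graph_hom hpsi.
  + by apply: qc_hom_graph_hom hphi => y; exact: svalP (phiS y).
- exists (omap psi'); split.
  + by case=> //= x; rewrite psiK.
  + by case=> //= y; rewrite psi'K.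
  + exact: graph_iso_qc_hom hQ hQ' psiK hpsi hpsi'.
  + exact: graph_iso_qc_hom hQ' hQ psi'K hpsi' hpsi.
Qed.
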